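(* Let $\mathcal{R}$ be an LCTRS and suppose $\Pi X.\,s\,[\exists\vec{x}.\varphi]\leadsto^*_{\mathcal R}\Pi Y.\,t\,[\exists\vec{y}.\psi]$. Then (1) for each $v\in[\![\Pi Y.\,t\,[\exists\vec{y}.\psi]]\!]$ there exists $u\in[\![\Pi X.\,s\,[\exists\vec{x}.\varphi]]\!]$ such that $u\to^*_{[\![\mathcal R]\!]}v$; and (2) there exist $u\in[\![\Pi X.\,s\,[\exists\vec{x}.\varphi]]\!]$ and $v\in[\![\Pi Y.\,t\,[\exists\vec{y}.\psi]]\!]$ such that $u\to^*_{[\![\mathcal R]\!]}v$.
   Context: Terms are built over a sorted signature whose function symbols are split into theory symbols (whose argument and result sorts are theory sorts) and term symbols, and a set $\mathcal{V}$ of sorted variables; theory sorts and symbols are interpreted in a fixed model $\mathcal{M}$. Every element of the interpretation of each theory sort is a constant symbol, called a value; $\mathcal{V}al$ denotes the set of values. There is a theory sort of Booleans with standard interpretation and the usual connectives. A constraint is a Boolean-sorted term built from theory symbols and variables; a (possibly existentially quantified) formula is valid if it is true under all valuations of its free variables in $\mathcal{M}$ and satisfiable if true under some. $\mathcal{V}ar(\cdot)$ is the set of variables. A substitution $\sigma$ is a sort-preserving map from variables to terms with finite domain $\mathcal{D}om(\sigma)=\{x\mid \sigma(x)\neq x\}$; $\mathcal{V}Dom(\sigma)=\{x\mid\sigma(x)\in\mathcal{V}al\}$; $\sigma$ is $X$-valued if $\sigma(X)\subseteq\mathcal{V}al$. An existential constraint $\exists\vec{x}.\varphi$ is a sequence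 of variables $\vec x$ together with a constraint $\varphi$ with $\{\vec x\}\subseteq\mathcal{V}ar(\varphi)$; its free variables are $\mathcal{FV}ar(\exists\vec x.\varphi)=\mathcal{V}ar(\varphi)\setminus\{\vec x\}$. For a substitution $\sigma$, $\sigma\vDash_{\mathcal M}\exists\vec x.\varphi$ means $\sigma$ is $\mathcal{FV}ar(\exists\vec x.\varphi)$-valued and $(\exists\vec x.\varphi)\sigma$ is valid. An existentially constrained term $\Pi X.\,s\,[\exists\vec x.\varphi]$ consists of a set $X$ of variables, a term $s$ and an existential constraint with $\mathcal{FV}ar(\exists\vec x.\varphi)\subseteq X\subseteq\mathcal{V}ar(s)$ and $\{\vec x\}\cap\mathcal{V}ar(s)=\emptyset$; it is satisfiable if $\exists\vec x.\varphi$ is satisfiable. A constrained rewrite rule $\rho\colon \Pi Z.\,\ell\to r\,[\pi]$ consists of a set $Z$ of variables, terms $\ell,r$ of the same sort and a constraint $\pi$ with $\mathcal{V}ar(\pi)\cup(\mathcal{V}ar(r)\setminus\mathcal{V}ar(\ell))\subseteq Z$; it is left-linear if $\ell$ is linear; $\mathcal{E}x\mathcal{V}ar(\rho)=\mathcal{V}ar(r)\setminus\mathcal{V}ar(\ell)$. Let $\Pi X.\,s\,[\exists\vec x.\varphi]$ be satisfiable, $\rho$ left-linear with $\mathcal{V}ar(\rho)\cap\mathcal{V}ar(s,\varphi)=\emptyset$, and $\{\vec z\}=\mathcal{V}ar(\pi)\setminus\mathcal{V}ar(\ell)$. The term has a partial $\rho$-redex at position $p$ of $s$ using $\gamma$ if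 (i) $\mathcal{D}om(\gamma)=\mathcal{V}ar(\ell)$, (ii) $s|_p=\ell\gamma$, (iii) $\gamma(x)\in\mathcal{V}al\cup X$ for all $x\in\mathcal{V}ar(\ell)\cap Z$, and (iv') $(\exists\vec x.\varphi)\wedge(\exists\vec z.\pi\gamma)$ is satisfiable; then, with $t=s[r\gamma]_p$, $\psi=\varphi\wedge\pi\gamma$, $\{\vec y\}=\mathcal{V}ar(\psi)\setminus\mathcal{V}ar(t)$, $Y=\mathcal{E}x\mathcal{V}ar(\rho)\cup(X\cap\mathcal{V}ar(t))$, there is a partial rewrite step $\Pi X.\,s\,[\exists\vec x.\varphi]\leadsto^p_{\rho,\gamma}\Pi Y.\,t\,[\exists\vec y.\psi]$. One writes $\leadsto_\rho$ if such a step exists for some position, some $\gamma$ and some renamed variant of $\rho$ whose variables are disjoint from those of the source term. An LCTRS $\mathcal R$ is a set of left-linear constrained rewrite rules (including the calculation rules for theory symbols); $\leadsto_{\mathcal R}=\bigcup_{\rho\in\mathcal R}\leadsto_\rho$ and $\leadsto^*_{\mathcal R}$ is its reflexive–transitive closure. For a set $R$ of pairs of ordinary terms, $u\to^p_R v$ means there are $\langle l,r'\rangle\in R$ and a substitution $\theta$ with $u|_p=l\theta$ and $v=u[r'\theta]_p$; $\to_R$ is the union over all positions and $\to^*_R$ its reflexive–transitive closure. Interpretation of a constrained term: $[\![\Pi X.\,s\,[\exists\vec x.\varphi]]\!]=\{s\sigma\mid\sigma(X)\subseteq\mathcal{V}al,\ \sigma\vDash_{\mathcal M}\exists\vec x.\varphi\}$.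 Interpretation of a rule $\rho\colon\Pi Z.\,\ell\to r\,[\pi]$: $[\![\rho]\!]=\{\langle\ell\sigma,r\sigma\rangle\mid\mathcal{D}om(\sigma)=\mathcal{V}Dom(\sigma)=Z\cap\mathcal{V}ar(\ell,r),\ \sigma\vDash_{\mathcal M}\exists\vec z'.\pi\}$ where $\{\vec z'\}=\mathcal{V}ar(\pi)\setminus\mathcal{V}ar(\ell,r)$; $[\![\mathcal R]\!]=\bigcup_{\rho\in\mathcal R}[\![\rho]\!]$.
   Formalization: Part (2) is stated for a satisfiable starting constrained term (automatic after at least one step; false for zero steps from an unsatisfiable one), and the sets X of constrained terms and Z of rules are taken to consist of theory-sorted variables, since otherwise interpretations may be empty. *)

(* Defs.v *)
From mathcomp Require Import all_boot.
From mathcomp Require Import boolp classical_sets functions cardinality.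
From Stdlib Require Import Relation_Operators.

Set Implicit Arguments.
Unset Strict Implicit.
Unset Printing Implicit Defensive.

Local Open Scope classical_set_scope.

(* A sorted signature together with its fixed model.  The carrier of a theory
   sort k is [set v : value | val_sort v = k], so that value is the disjoint union
   of all carriers.  Values are constant symbols, but they are not listed in
   fsym: they enter terms through the constructor tval below.  The function
   finterp is total only for convenience: it is constrained (and used) only for
   theory symbols applied to arguments of the right sorts.  The equality
   symbols are those occurring in calculation rules. *)
Record signature := Signature {
  sort : eqType;
  th_sort : pred sort;
  var : eqType;
  var_sort : var -> sort;
  value : eqType;
  val_sort : value -> sort;
  fsym : Type;
  th_sym : pred fsym;
  fdom : fsym -> seq sort;
  fcod : fsym -> sort;
  finterp : fsym -> seq value -> value;
  bool_sort : sort;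
  vbool : bool -> value;
  f_neg : fsym;
  f_conj : fsym;
  f_disj : fsym;
  f_impl : fsym;
  f_eq : sort -> fsym;
  val_sort_th : forall v, th_sort (val_sort v);
  carrier_nonempty : forall k, th_sort k -> exists v, val_sort v = k;
  th_sym_dom : forall f, th_sym f -> all th_sort (fdom f);
  th_sym_cod : forall f, th_sym f -> th_sort (fcod f);
  finterp_sort : forall f vs, th_sym f -> map val_sort vs = fdom f ->
    val_sort (finterp f vs) = fcod f;
  bool_sort_th : th_sort bool_sort;
  vbool_inj : injective vbool;
  bool_carrier : forall v, val_sort v = bool_sort <-> exists b, v = vbool b;
  f_negP : [/\ th_sym f_neg, fdom f_neg = [:: bool_sort],
    fcod f_neg = bool_sort &
    forall a, finterp f_neg [:: vbool a] = vbool (~~ a)];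
  f_conjP : [/\ th_sym f_conj, fdom f_conj = [:: bool_sort; bool_sort],
    fcod f_conj = bool_sort &
    forall a b, finterp f_conj [:: vbool a; vbool b] = vbool (a && b)];
  f_disjP : [/\ th_sym f_disj, fdom f_disj = [:: bool_sort; bool_sort],
    fcod f_disj = bool_sort &
    forall a b, finterp f_disj [:: vbool a; vbool b] = vbool (a || b)];
  f_implP : [/\ th_sym f_impl, fdom f_impl = [:: bool_sort; bool_sort],
    fcod f_impl = bool_sort &
    forall a b, finterp f_impl [:: vbool a; vbool b] = vbool (a ==> b)];
  f_eqP : forall k, th_sort k ->
    [/\ th_sym (f_eq k), fdom (f_eq k) = [:: k; k], fcod (f_eq k) = bool_sort &
    forall a b, val_sort a = k -> val_sort b = k ->
      finterp (f_eq k) [:: a; b] = vbool (a == b)]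
}.

Section Terms.
Variable S : signature.

Inductive term :=
| tvar of var S
| tval of value S
| tapp of fsym S & seq term.

Definition tsort (t : term) : sort S :=
  match t with
  | tvar x => var_sort x
  | tval v => val_sort v
  | tapp f _ => fcod f
  end.

Fixpoint well_sorted (t : term) : bool :=
  match t with
  | tapp f ts => (map tsort ts == fdom f) && all well_sorted ts
  | _ => true
  end.

(* Occurrences are listed with their multiplicity. *)
Fixpoint vars (t : term) : seq (var S) :=
  match t with
  | tvar x => [:: x]
  | tval _ => [::]
  | tapp _ ts => flatten (map vars ts)
  end.

Definition Var (t : term) : set (var S) := [set` vars t].

Definition linear_term (t : term) : bool := uniq (vars t).

Definition is_value (t : term) : Prop := exists v, t = tval v.

Definition theory_var (x : var S) : bool := th_sort (var_sort x).

Fixpoint theory_term (t : term) : bool :=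
  match t with
  | tapp f ts => th_sym f && all theory_term ts
  | _ => true
  end.

Definition is_constraint (t : term) : bool :=
  [&& well_sorted t, theory_term t & tsort t == bool_sort S].

Definition tconj (a b : term) : term := tapp (f_conj S) [:: a; b].

Fixpoint tsubst (f : var S -> term) (t : term) : term :=
  match t with
  | tvar x => f x
  | tval v => tval v
  | tapp g ts => tapp g (map (tsubst f) ts)
  end.

Record substitution := Substitution {
  subst_fun :> var S -> term;
  subst_sorted : forall x,
    well_sorted (subst_fun x) /\ tsort (subst_fun x) = var_sort x;
  subst_finite : finite_set [set x | subst_fun x <> tvar x]
}.

Definition Dom (s : substitution) : set (var S) := [set x | s x <> tvar x].
Definition VDom (s : substitution) : set (var S) := [set x | is_value (s x)].
Definition valued_on (X : set (var S)) (s : substitution) : Prop :=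
  forall x, X x -> is_value (s x).

Fixpoint subterm (t : term) (p : seq nat) : option term :=
  match p with
  | [::] => Some t
  | i :: q =>
    if t is tapp _ ts then
      if onth ts i is Some u then subterm u q else None
    else None
  end.

(* Only meaningful when p is a position of t. *)
Fixpoint replace (t : term) (p : seq nat) (u : term) : term :=
  match p with
  | [::] => u
  | i :: q =>
    if t is tapp f ts then
      if onth ts i is Some w then tapp f (set_nth w ts i (replace w q u)) else t
    else t
  end.

(* Valuations are only constrained on theory variables; the other variables
   do not occur in constraints. *)
Definition valuation (eta : var S -> value S) : Prop :=
  forall x, theory_var x -> val_sort (eta x) = var_sort x.

Fixpoint eval (eta : var S -> value S) (t : term) : value S :=
  match t with
  | tvar x => eta x
  | tval v => v
  | tapp f ts => finterp f (map (eval eta) ts)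
  end.

Record econstr := EConstr { ec_bvars : seq (var S); ec_body : term }.

Definition is_econstr (e : econstr) : Prop :=
  is_constraint (ec_body e) /\ [set` ec_bvars e] `<=` Var (ec_body e).

Definition FVar (e : econstr) : set (var S) :=
  Var (ec_body e) `\` [set` ec_bvars e].

Definition ec_holds (eta : var S -> value S) (e : econstr) : Prop :=
  exists eta', [/\ valuation eta',
    (forall x, x \notin ec_bvars e -> eta' x = eta x) &
    eval eta' (ec_body e) = vbool S true].

Definition ec_valid (e : econstr) : Prop :=
  forall eta, valuation eta -> ec_holds eta e.

Definition ec_sat (e : econstr) : Prop :=
  exists2 eta, valuation eta & ec_holds eta e.

(* Bound variables are left untouched; there is no capture when s maps the
   free variables to values, the only case in which this is used. *)
Definition ec_subst (s : var S -> term) (e : econstr) : econstr :=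
  EConstr (ec_bvars e)
    (tsubst (fun x => if x \in ec_bvars e then tvar x else s x) (ec_body e)).

Definition models (s : substitution) (e : econstr) : Prop :=
  valued_on (FVar e) s /\ ec_valid (ec_subst s e).

(* The variables in ct_vars (and in r_vars below) are logical variables, to be
   instantiated by values, hence of theory sort. *)
Record ecterm := ECTerm {
  ct_vars : set (var S);
  ct_term : term;
  ct_constr : econstr;
  ct_well_sorted : well_sorted ct_term;
  ct_is_econstr : is_econstr ct_constr;
  ct_theory_vars : ct_vars `<=` [set x | theory_var x];
  ct_fvars : FVar ct_constr `<=` ct_vars;
  ct_vars_sub : ct_vars `<=` Var ct_term;
  ct_bvars : [set` ec_bvars ct_constr] `&` Var ct_term = set0
}.

Definition ct_sat (c : ecterm) : Prop := ec_sat (ct_constr c).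

Definition ct_interp (c : ecterm) : set term :=
  [set u | exists s : substitution,
    [/\ valued_on (ct_vars c) s, models s (ct_constr c) &
        u = tsubst s (ct_term c)]].

Record rule := Rule {
  r_vars : set (var S);
  r_lhs : term;
  r_rhs : term;
  r_constr : term;
  r_lhs_sorted : well_sorted r_lhs;
  r_rhs_sorted : well_sorted r_rhs;
  r_same_sort : tsort r_lhs = tsort r_rhs;
  r_is_constraint : is_constraint r_constr;
  r_theory_vars : r_vars `<=` [set x | theory_var x];
  r_vars_sub : Var r_constr `|` (Var r_rhs `\` Var r_lhs) `<=` r_vars
}.

Definition r_Var (rho : rule) : set (var S) :=
  Var (r_lhs rho) `|` Var (r_rhs rho) `|` Var (r_constr rho).

Definition ExVar (rho : rule) : set (var S) :=
  Var (r_rhs rho) `\` Var (r_lhs rho).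

Definition left_linear (rho : rule) : bool := linear_term (r_lhs rho).

Definition rename_term (d : var S -> var S) : term -> term :=
  tsubst (fun x => tvar (d x)).

Definition variant (rho rho' : rule) : Prop :=
  exists d : var S -> var S,
    [/\ bijective d, forall x, var_sort (d x) = var_sort x &
    [/\ r_vars rho' = d @` r_vars rho,
        r_lhs rho' = rename_term d (r_lhs rho),
        r_rhs rho' = rename_term d (r_rhs rho) &
        r_constr rho' = rename_term d (r_constr rho)]].

Definition r_interp (rho : rule) : set (term * term) :=
  [set lr | exists s : substitution,
    [/\ Dom s = r_vars rho `&` (Var (r_lhs rho) `|` Var (r_rhs rho)),
        VDom s = Dom s,
        models s (EConstr [seq z <- vars (r_constr rho) |
          z \notin vars (r_lhs rho) ++ vars (r_rhs rho)] (r_constr rho)) &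
        lr = (tsubst s (r_lhs rho), tsubst s (r_rhs rho))]].

Definition trs_interp (R : set rule) : set (term * term) :=
  \bigcup_(rho in R) r_interp rho.

Definition rewrite_at (T : set (term * term)) (p : seq nat) (u v : term) :=
  exists l r (th : substitution),
    [/\ T (l, r), subterm u p = Some (tsubst th l) &
        v = replace u p (tsubst th r)].

Definition rewrite_step (T : set (term * term)) (u v : term) : Prop :=
  exists p, rewrite_at T p u v.

Definition rewrite_steps (T : set (term * term)) : term -> term -> Prop :=
  clos_refl_trans term (rewrite_step T).

Definition partial_redex (c : ecterm) (rho : rule) (p : seq nat)
    (g : substitution) : Prop :=
  [/\ Dom g = Var (r_lhs rho),
      subterm (ct_term c) p = Some (tsubst g (r_lhs rho)),
      (forall x, Var (r_lhs rho) x -> r_vars rho x ->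
         is_value (g x) \/ exists2 y, ct_vars c y & g x = tvar y) &
      exists eta, [/\ valuation eta, ec_holds eta (ct_constr c) &
        ec_holds eta (EConstr
          [seq z <- vars (r_constr rho) | z \notin vars (r_lhs rho)]
          (tsubst g (r_constr rho)))]].

Definition partial_step_at (rho : rule) (p : seq nat) (g : substitution)
    (c c' : ecterm) : Prop :=
  let t := replace (ct_term c) p (tsubst g (r_rhs rho)) in
  let psi := tconj (ec_body (ct_constr c)) (tsubst g (r_constr rho)) in
  [/\ ct_sat c, left_linear rho,
      r_Var rho `&` (Var (ct_term c) `|` Var (ec_body (ct_constr c))) = set0,
      partial_redex c rho p g &
  [/\ ct_vars c' = ExVar rho `|` (ct_vars c `&` Var t),
      ct_term c' = t,
      [set` ec_bvars (ct_constr c')] = Var psi `\` Var t &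
      ec_body (ct_constr c') = psi]].

Definition partial_step_rule (rho : rule) (c c' : ecterm) : Prop :=
  exists rho' p g, variant rho rho' /\ partial_step_at rho' p g c c'.

Definition partial_step (R : set rule) (c c' : ecterm) : Prop :=
  exists2 rho, R rho & partial_step_rule rho c c'.

(* The reflexive part relates every constrained term to itself, including
   unsatisfiable ones, from which no proper step starts. *)
Definition partial_steps (R : set rule) : ecterm -> ecterm -> Prop :=
  clos_refl_trans ecterm (partial_step R).

(* The calculation rule  f(x1,...,xn) -> y [y = f(x1,...,xn)]. *)
Definition calculation_rule (f : fsym S) (rho : rule) : Prop :=
  exists (xs : seq (var S)) (y : var S),
    let fxs := tapp f (map tvar xs) in
    [/\ uniq (y :: xs), map (@var_sort S) xs = fdom f, var_sort y = fcod f &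
    [/\ r_vars rho = [set` y :: xs], r_lhs rho = fxs, r_rhs rho = tvar y &
        r_constr rho = tapp (f_eq (fcod f)) [:: tvar y; fxs]]].

Definition lctrs (R : set rule) : Prop :=
  (forall rho, R rho -> left_linear rho) /\
  (forall f, th_sym f -> exists2 rho, R rho & calculation_rule f rho).

End Terms.

(* Main.v *)
From mathcomp Require Import all_boot.
From mathcomp Require Import boolp classical_sets cardinality.
From Stdlib Require Import Relation_Operators.
Require Import Defs.

(** Given [v = t s'] in the interpretation of the target of a step with rule
    [Pi Z. l -> r [pi]] and matching substitution [g], the validity of
    [(exists y. psi) s'] yields a valuation [delta] of all variables that
    satisfies both [phi] and [pi g] and agrees with [s'] on the free logical
    variables. Letting [sigma] be [delta] on [X] and [s'] elsewhere gives
    [t s' = t sigma], an instance [s sigma] of the source, and an instance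
    [(l g sigma, r g sigma)] of the rule that rewrites one to the other.
    This backward simulation gives (1); since partial steps preserve
    satisfiability and satisfiable constrained terms have instances, (1)
    applied to any instance of the target gives (2). *)

Set Implicit Arguments.
Unset Strict Implicit.
Unset Printing Implicit Defensive.

Local Open Scope classical_set_scope.

(** * Lists compared index by index *)

Lemma map_onth (T U : Type) (a b : T -> U) (ts : seq T) :
  (forall i t, onth ts i = Some t -> a t = b t) -> map a ts = map b ts.
Proof.
elim: ts => [//|t ts IH] H /=; congr (_ :: _); first exact: (H 0).
by apply: IH => i; exact: (H i.+1).
Qed.

Lemma all_onth (T : Type) (a : pred T) (ts : seq T) :
  (forall i t, onth ts i = Some t -> a t) -> all a ts.
Proof.
elim: ts => [//|t ts IH] H /=; rewrite (H 0) //=.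
by apply: IH => i; exact: (H i.+1).
Qed.

Lemma all_onthP (T : Type) (a : pred T) (ts : seq T) i t :
  all a ts -> onth ts i = Some t -> a t.
Proof.
by elim: ts i => [|u us IH] [|i] //= /andP[au aus]; [case=> <-|exact: IH].
Qed.

Lemma map_set_nth (T U : Type) (a : T -> U) (ts : seq T) i t u :
  onth ts i = Some t ->
  map a (set_nth t ts i u) = set_nth (a t) (map a ts) i (a u).
Proof.
by elim: ts i => [|t0 ts IH] [|i] //= /IH ->.
Qed.

(** * Terms: induction, substitution, evaluation and positions *)

Section PartialRewriting.
Variable S : signature.
Implicit Types (t u w : term S) (x y : var S) (f g : var S -> term S).
Implicit Types (eta delta : var S -> value S) (s : substitution S).

(** The arguments of [tapp] are nested in a list, so the generated principle carries no hypothesis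
    about them. Access through [onth] matches [map_onth] and [all_onth]. *)
Lemma term_nested_ind (P : term S -> Prop) :
  (forall x, P (tvar x)) -> (forall v, P (tval v)) ->
  (forall h ts, (forall i t, onth ts i = Some t -> P t) -> P (tapp h ts)) ->
  forall t, P t.
Proof.
move=> Pvar Pval Papp; fix IH 1 => -[x|v|h ts]; [exact: Pvar|exact: Pval|].
apply: Papp; elim: ts => [|u us IHus] [|i] t /=.
- discriminate.
- discriminate.
- by case=> <-; exact: IH.
- exact: IHus.
Qed.

Lemma vars_onth h (ts : seq (term S)) i t x :
  onth ts i = Some t -> x \in vars t -> x \in vars (tapp h ts).
Proof.
rewrite /=; elim: ts i => [|u us IH] [|i] //=; rewrite mem_cat.
  by case=> -> ->.
by move=> /IH{}IH /IH ->; rewrite orbT.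
Qed.

Lemma eq_tsubst f g t :
  (forall x, x \in vars t -> f x = g x) -> tsubst f t = tsubst g t.
Proof.
elim/term_nested_ind: t => [x|//|h ts IH] /= fg.
  by apply: fg; rewrite inE.
congr tapp; apply: map_onth => i t ti; apply: (IH i t ti) => x xt.
exact: fg (vars_onth h ti xt).
Qed.

Lemma eq_eval eta delta t :
  (forall x, x \in vars t -> eta x = delta x) -> eval eta t = eval delta t.
Proof.
elim/term_nested_ind: t => [x|//|h ts IH] /= fg.
  by apply: fg; rewrite inE.
congr finterp; apply: map_onth => i t ti; apply: (IH i t ti) => x xt.
exact: fg (vars_onth h ti xt).
Qed.

Lemma tsubst_tsubst f g t :
  tsubst f (tsubst g t) = tsubst (fun x => tsubst f (g x)) t.
Proof.
elim/term_nested_ind: t => //= h ts IH; congr tapp; rewrite -map_comp.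
exact: map_onth.
Qed.

Lemma eval_tsubst eta f t :
  eval eta (tsubst f t) = eval (fun x => eval eta (f x)) t.
Proof.
elim/term_nested_ind: t => //= h ts IH; congr finterp; rewrite -map_comp.
exact: map_onth.
Qed.

Lemma tsubst_sorted f t :
  (forall x, well_sorted (f x) /\ tsort (f x) = var_sort x) ->
  well_sorted t ->
  well_sorted (tsubst f t) /\ tsort (tsubst f t) = tsort t.
Proof.
move=> fs; elim/term_nested_ind: t => [x _|//|h ts IH] /=; first exact: fs.
case/andP=> /eqP <- wts; split=> //; apply/andP; split.
  apply/eqP; rewrite -map_comp; apply: map_onth => i t ti /=.
  by have [] := IH i t ti (all_onthP wts ti).
rewrite all_map; apply: all_onth => i t ti /=.
by have [] := IH i t ti (all_onthP wts ti).
Qed.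

Lemma subterm_tsubst f t p u :
  subterm t p = Some u -> subterm (tsubst f t) p = Some (tsubst f u).
Proof.
elim: p t => [|i p IH] t /=; first by case=> ->.
case: t => // h ts /=; rewrite onth_map.
by case: (onth ts i) => [w|//] /IH.
Qed.

Lemma replace_tsubst f t p u w :
  subterm t p = Some w ->
  tsubst f (replace t p u) = replace (tsubst f t) p (tsubst f u).
Proof.
elim: p t => [//|i p IH] t /=; case: t => // h ts /=; rewrite onth_map.
case E: (onth ts i) => [t'|//] /= /IH <-; congr tapp.
exact: map_set_nth.
Qed.

(** * Valuations and constraints *)

Lemma exists_valuation : exists eta, @valuation S eta.
Proof.
have H x : exists v : value S, theory_var x -> val_sort v = var_sort x.
  case E: (theory_var x); last by exists (vbool S true).
  by have [v vE] := carrier_nonempty E; exists v.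
by have [eta etaP] := choice H; exists eta.
Qed.

Lemma eval_sort eta t : valuation eta -> well_sorted t -> theory_term t ->
  th_sort (tsort t) -> val_sort (eval eta t) = tsort t.
Proof.
move=> etaP; elim/term_nested_ind: t => [x _ _|//|h ts IH] /=; first exact: etaP.
case/andP=> /eqP sts wts /andP[th tts] _; apply: finterp_sort => //.
rewrite -sts -map_comp; apply: map_onth => i t ti /=.
apply: (IH i t ti); [exact: all_onthP wts ti|exact: all_onthP tts ti|].
have := th_sym_dom th; rewrite -sts all_map => all_th.
exact: all_onthP all_th ti.
Qed.

Lemma eval_constraint eta t : valuation eta -> is_constraint t ->
  exists b, eval eta t = vbool S b.
Proof.
move=> etaP /and3P[wt tt /eqP st]; apply/bool_carrier.
by rewrite eval_sort // st bool_sort_th.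
Qed.

Lemma is_constraint_tconj t u :
  is_constraint (tconj t u) -> is_constraint t /\ is_constraint u.
Proof.
have [_ dom_conj _ _] := f_conjP S.
rewrite /is_constraint /= dom_conj => /and3P[].
case/andP=> /eqP[-> ->] /and3P[-> -> _] /and4P[_ -> -> _] _.
by rewrite eqxx.
Qed.

(** [f_conj] is specified only on Booleans, so both conjuncts must first be known to evaluate to
    some [vbool]. *)
Lemma eval_tconj eta t u : valuation eta ->
  is_constraint t -> is_constraint u ->
  eval eta (tconj t u) = vbool S true <->
  eval eta t = vbool S true /\ eval eta u = vbool S true.
Proof.
move=> etaP ct cu; have [_ _ _ conjE] := f_conjP S.
have [[a aE] [b bE]] := (eval_constraint etaP ct, eval_constraint etaP cu).
rewrite /= aE bE conjE; split=> [/vbool_inj/andP[-> ->] //|].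
by case=> /vbool_inj -> /vbool_inj ->.
Qed.

(** * Building substitutions, models and instances *)

Lemma exists_override (A : set (var S)) f s : finite_set A ->
  (forall x, A x -> well_sorted (f x) /\ tsort (f x) = var_sort x) ->
  exists s' : substitution S, forall x, s' x = if x \in A then f x else s x.
Proof.
move=> finA fs.
have sorted x : let u := if x \in A then f x else s x in
    well_sorted u /\ tsort u = var_sort x.
  by case: ifP => [/set_mem /fs //|_]; exact: subst_sorted.
have fin : finite_set [set x | (if x \in A then f x else s x) <> tvar x].
  apply: (@sub_finite_set _ _ (A `|` Dom s)).
    by move=> x /=; case: ifP => [/set_mem|_]; [left|right].
  by rewrite finite_setU; split=> //; exact: subst_finite.
by exists (Substitution sorted fin).
Qed.

Lemma exists_id_subst : exists s : substitution S, forall x, s x = tvar x.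
Proof.
have fin : finite_set [set x | tvar x <> tvar x :> term S].
  by rewrite (_ : [set _ | _] = set0) // -subset0 => x /=.
by exists (@Substitution S (@tvar S) (fun x => conj isT (erefl (var_sort x))) fin).
Qed.

Lemma subst_value_sort s x v : s x = tval v -> val_sort v = var_sort x.
Proof. by move=> sx; have [_] := subst_sorted s x; rewrite sx. Qed.

(** Validity at an arbitrary valuation supplies witnesses for the bound variables; at the free
    variables, the values are read off [s]. *)
Lemma models_valuation s e : models s e ->
  exists delta, [/\ valuation delta, eval delta (ec_body e) = vbool S true &
    forall x v, x \notin ec_bvars e -> s x = tval v -> delta x = v].
Proof.
case=> valued valid; have [eta /valid [eta' [eta'P _ /=]]] := exists_valuation.
rewrite eval_tsubst => body_true.
pose delta x := if x \in ec_bvars e then eta' x else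
  if s x is tval v then v else eta' x.
exists delta; split.
- move=> x xth; rewrite /delta; case: ifP => _; first exact: eta'P.
  case sx: (s x) => [y|v|h ts]; by [exact: eta'P|exact: subst_value_sort sx].
- rewrite -body_true; apply: eq_eval => x xe; rewrite /delta.
  case: ifP => // /negbT xb; have [|v -> //] := valued x.
  by split=> //; exact/negP.
- by move=> x v /negbTE xb sx; rewrite /delta xb sx.
Qed.

(** Once [s] has replaced the free variables by values, the body depends only on the bound ones, for
    which [delta] provides witnesses whatever the outer valuation is. *)
Lemma valuation_models s e delta : valuation delta ->
  eval delta (ec_body e) = vbool S true ->
  (forall x, FVar e x -> s x = tval (delta x)) -> models s e.
Proof.
move=> deltaP body_true sE; split=> [x /sE ->|eta etaP]; first by eexists.
exists (fun x => if x \in ec_bvars e then delta x else eta x); split.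
- by move=> x xth; case: ifP => _; [exact: deltaP|exact: etaP].
- by move=> x /negbTE /= ->.
- rewrite -body_true /= eval_tsubst; apply: eq_eval => x xe.
  case: ifP => [xb|/negbT xb] /=; first by rewrite xb.
  by rewrite sE //; split=> //; exact/negP.
Qed.

Lemma finite_Var t : finite_set (Var t).
Proof. exact: finite_seq. Qed.

Lemma ct_interp_sat (c : ecterm S) : ct_sat c -> exists u, ct_interp c u.
Proof.
case=> eta _ [delta [deltaP _ body_true]]; have [s0 s0E] := exists_id_subst.
have [||s sE] := @exists_override (ct_vars c) (fun x => tval (delta x)) s0.
- exact: sub_finite_set (@ct_vars_sub _ c) (finite_Var _).
- by move=> x /ct_theory_vars /deltaP.
have sX x : ct_vars c x -> s x = tval (delta x) by move=> /mem_set xX; rewrite sE xX.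
exists (tsubst s (ct_term c)), s; split=> //.
  by move=> x /sX ->; eexists.
by apply: valuation_models deltaP body_true _ => x /ct_fvars /sX.
Qed.

(** A pair in [r_interp rho] instantiates exactly the logical variables of both sides, and only by
    values. So [f] is factored into a valued part [m], which forms the pair, and a matcher [th] for
    the remaining variables. *)
Lemma rule_instance (rho : rule S) f delta :
  (forall x, well_sorted (f x) /\ tsort (f x) = var_sort x) ->
  (forall x, r_vars rho x -> (Var (r_lhs rho) `|` Var (r_rhs rho)) x ->
     is_value (f x)) ->
  valuation delta -> eval delta (r_constr rho) = vbool S true ->
  (forall x, Var (r_constr rho) x -> (Var (r_lhs rho) `|` Var (r_rhs rho)) x ->
     f x = tval (delta x)) ->
  exists l r (th : substitution S), [/\ r_interp rho (l, r),
    tsubst th l = tsubst f (r_lhs rho) & tsubst th r = tsubst f (r_rhs rho)].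
Proof.
move=> fs fval deltaP pi_true fdelta; have [s0 s0E] := exists_id_subst.
set V := Var (r_lhs rho) `|` Var (r_rhs rho).
have finV : finite_set V by rewrite finite_setU; split; exact: finite_Var.
have [|//|m mE] := @exists_override (r_vars rho `&` V) f s0.
  exact: sub_finite_set (@subIsetr _ _ _) finV.
have [//|//|th thE] := @exists_override V f s0.
(* The values put in by [m] are fixed by [th]; elsewhere [m] is the identity and [th] acts as
   [f]. *)
have th_m t : Var t `<=` V -> tsubst th (tsubst m t) = tsubst f t.
  move=> tV; rewrite tsubst_tsubst; apply: eq_tsubst => x /tV xV; rewrite mE.
  case: ifP => [/set_mem[xZ _]|_]; first by have [v ->] := fval x xZ xV.
  by rewrite s0E /= thE mem_set.
exists (tsubst m (r_lhs rho)), (tsubst m (r_rhs rho)), th; split; first last.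
- by apply: th_m; exact: subsetUr.
- by apply: th_m; exact: subsetUl.
have DomE : Dom m = r_vars rho `&` V.
  apply/seteqP; split=> x; rewrite /Dom /= mE.
    by case: ifP => [/set_mem //|_]; rewrite s0E.
  by move=> xZV; rewrite mem_set //; case: xZV => xZ /(fval x xZ)[v ->].
exists m; split=> //.
- rewrite DomE; apply/seteqP; split=> x; rewrite /VDom /= mE.
    by case: ifP => [/set_mem //|_] [v]; rewrite s0E.
  by move=> xZV; rewrite mem_set //; case: xZV => xZ; exact: fval.
- apply: (valuation_models deltaP) => [//|x [/= xpi /negP]].
  rewrite mem_filter xpi andbT negbK mem_cat => /orP xV.
  rewrite mE mem_set; first exact: fdelta.
  by split=> //; apply: r_vars_sub; left.
Qed.

Lemma vars_rename (d : var S -> var S) t x :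
  x \in vars t -> d x \in vars (rename_term d t).
Proof.
elim/term_nested_ind: t => [y|//|h ts IH]; first by rewrite !inE => /eqP ->.
rewrite /=; elim: ts IH => [//|t ts IHts] IH /=; rewrite !mem_cat.
case/orP=> [xt|xts]; apply/orP; first by left; exact: (IH 0 t).
by right; apply: IHts xts => i u; exact: (IH i.+1 u).
Qed.

(** * A single partial step *)

Section Step.
Variables (rho : rule S) (p : seq nat) (g : substitution S) (c c' : ecterm S).
Hypothesis step : partial_step_at rho p g c c'.

Let phi := ec_body (ct_constr c).

Let rule_fresh x : r_Var rho x -> ~ Var (ct_term c) x /\ ~ Var phi x.
Proof.
case: step => _ _ /seteqP[fresh _] _ _ xr.
by split=> xc; apply: (fresh x); split=> //; [left|right].
Qed.

Let g_id x : ~ Var (r_lhs rho) x -> g x = tvar x.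
Proof.
case: step => _ _ _ [<- _ _ _] _ xl; apply: contrapT => gx; exact: xl gx.
Qed.

Let g_redex x : Var (r_lhs rho) x -> r_vars rho x ->
  is_value (g x) \/ exists2 y, ct_vars c y & g x = tvar y.
Proof. by case: step => _ _ _ [_ _ gX _] _; exact: gX. Qed.

Let constr_vars : Var (r_constr rho) `<=` r_vars rho.
Proof. by move=> x xpi; apply: r_vars_sub; left. Qed.

(** Both facts are read off the target [c'], whose body is the conjunction of the two. *)
Let constr_conj : is_constraint phi /\ is_constraint (tsubst g (r_constr rho)).
Proof.
apply: is_constraint_tconj; case: step => _ _ _ _ [_ _ _ <-].
by have [] := ct_is_econstr c'.
Qed.

(** The redex condition gives witnesses for [phi] and for the instantiated rule constraint over a
    common [eta]. They glue into one valuation because the rule variables are fresh for the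
    source. *)
Lemma partial_step_sat : ct_sat c'.
Proof.
have [cphi cpi] := constr_conj.
have [_ _ _ [_ _ _ [eta [etaP [eta1 [eta1P eta1E phi_true]]]]]] := step.
case=> eta2 [eta2P /= eta2E pi_true] [_ _ _ bodyE].
set zs := [seq z <- _ | _] in eta2E.
have zsP x : x \in zs -> r_Var rho x.
  by rewrite mem_filter => /andP[_ xpi]; right.
pose delta x := if x \in ec_bvars (ct_constr c) then eta1 x else
  if x \in zs then eta2 x else eta x.
have deltaP : valuation delta.
  by move=> x xth; rewrite /delta; do 2?case: ifP => _; auto.
exists delta => //; exists delta; split=> //; rewrite bodyE.
apply/(eval_tconj deltaP cphi cpi); split.
  rewrite -phi_true; apply: eq_eval => x xphi; rewrite /delta.
  case: ifPn => [//|xb]; rewrite eta1E //; case: ifP => // /zsP /rule_fresh.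
  by case.
(* A logical variable of the source occurs in its term, so it is neither bound there nor in [zs]:
   both sides equal [eta x]. *)
have delta_eta x : ct_vars c x -> delta x = eta2 x.
  move=> xX; have xs : Var (ct_term c) x by exact: ct_vars_sub.
  have xz : x \notin zs by apply/negP => /zsP /rule_fresh[].
  rewrite /delta (negbTE xz) eta2E // ifN //; apply/negP => xb.
  by have /seteqP[/(_ x) H _] := ct_bvars c; apply: H.
rewrite -pi_true !eval_tsubst; apply: eq_eval => x xpi.
have [xl|xl] := pselect (Var (r_lhs rho) x).
  by have [[v ->]|[y yX ->]] := g_redex xl (constr_vars xpi); rewrite //= delta_eta.
rewrite g_id //= /delta; have xz : x \in zs by rewrite mem_filter xpi andbT; exact/negP.
rewrite xz ifN //; apply/negP => xb; have [_] := rule_fresh (zsP _ xz).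
by apply; have [_] := ct_is_econstr c; apply.
Qed.

(** [rho] may be a renamed variant here, so the result is given as raw data [f] and [delta], which
    can still be precomposed with a renaming. *)
Lemma partial_step_instance v : ct_interp c' v ->
  exists f delta, [/\ forall x, well_sorted (f x) /\ tsort (f x) = var_sort x,
    forall x, r_vars rho x -> (Var (r_lhs rho) `|` Var (r_rhs rho)) x ->
      is_value (f x),
    valuation delta /\ eval delta (r_constr rho) = vbool S true,
    forall x, Var (r_constr rho) x ->
      (Var (r_lhs rho) `|` Var (r_rhs rho)) x -> f x = tval (delta x) &
    exists2 u, ct_interp c u & subterm u p = Some (tsubst f (r_lhs rho)) /\
      v = replace u p (tsubst f (r_rhs rho))].
Proof.
case=> s' [s'Y s'_models ->]; have [cphi cpi] := constr_conj.
have [delta [deltaP]] := models_valuation s'_models.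
have [_ _ _ [_ sub_p _ _] [YE tE _ ->]] := step.
case/(eval_tconj deltaP cphi cpi)=> phi_true pi_true deltaE.
(* Logical variables of the target occur in its term, hence are not bound by its constraint. *)
have deltaY x : ct_vars c' x -> s' x = tval (delta x).
  move=> xY; have [w s'x] := s'Y x xY; rewrite s'x; congr tval; symmetry.
  apply: deltaE s'x; apply/negP => xb.
  have /seteqP[/(_ x) H _] := ct_bvars c'; apply: H; split=> //.
  exact: ct_vars_sub.
(* Logical variables of the source that the step erases are bound in the target, where [s'] need not
   give them values; [delta] does. *)
have [||s sE] := @exists_override (ct_vars c) (fun x => tval (delta x)) s'.
- exact: sub_finite_set (@ct_vars_sub _ c) (finite_Var _).
- by move=> x /ct_theory_vars /deltaP.
have sX x : ct_vars c x -> s x = tval (delta x) by move=> /mem_set xX; rewrite sE xX.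
(* Extra variables are fixed by [g], lie outside [ct_vars c] by freshness, and are logical variables
   of the target. *)
have s_ex x : ExVar rho x -> tsubst s (g x) = tval (delta x).
  move=> xex; rewrite g_id; last by case: xex.
  rewrite /= sE memNset; first by apply: deltaY; rewrite YE; left.
  by move/ct_vars_sub; have [] : ~ Var (ct_term c) x /\ ~ Var phi x;
    [apply: rule_fresh; left; right; case: xex|].
have s_t : tsubst s' (ct_term c') = tsubst s (ct_term c').
  apply: eq_tsubst => x xt; rewrite sE; case: ifP => // /set_mem xX.
  by apply: deltaY; rewrite YE; right; split=> //; rewrite -tE.
(* [g x] is a value or a variable for every [x] in [pi], so the other branch
   only serves to make [delta'] a valuation on all variables. *)
pose delta' x := if g x is tapp _ _ then delta x else eval delta (g x).
have delta'E x : r_vars rho x -> delta' x = eval delta (g x).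
  move=> xZ; rewrite /delta'; have [xl|xl] := pselect (Var (r_lhs rho) x).
    by have [[w ->]|[y _ ->]] := g_redex xl xZ.
  by rewrite g_id.
have sgE x : r_vars rho x -> (Var (r_lhs rho) `|` Var (r_rhs rho)) x ->
    tsubst s (g x) = tval (delta' x).
  move=> xZ xlr; rewrite delta'E //.
  have [xl|xl] := pselect (Var (r_lhs rho) x).
    by have [[w ->]|[y yX ->]] //= := g_redex xl xZ; rewrite sX.
  by rewrite s_ex ?g_id //; split=> //; case: xlr.
exists (fun x => tsubst s (g x)), delta'; split.
- move=> x; have [gw <-] := subst_sorted g x.
  exact: tsubst_sorted (subst_sorted s) gw.
- by move=> x xZ /(sgE x xZ) ->; eexists.
- split; last first.
    rewrite -pi_true eval_tsubst; apply: eq_eval => x /constr_vars.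
    exact: delta'E.
  move=> x xth; rewrite /delta'; have [_] := subst_sorted g x.
  case: (g x) => [y|w|h ts] //= yx; last exact: deltaP.
  by rewrite deltaP // /theory_var yx.
- by move=> x /constr_vars; exact: sgE.
exists (tsubst s (ct_term c)).
  exists s; split=> //; first by move=> x /sX ->; eexists.
  by apply: valuation_models deltaP phi_true _ => x /ct_fvars /sX.
rewrite -!tsubst_tsubst (subterm_tsubst s sub_p) s_t tE; split=> //.
exact: replace_tsubst sub_p.
Qed.

End Step.

(** * Renamed variants and sequences of steps *)

Lemma partial_step_backward (R : set (rule S)) c c' v :
  partial_step R c c' -> ct_interp c' v ->
  exists2 u, ct_interp c u & rewrite_step (trs_interp R) u v.
Proof.
case=> rho Rrho [rho' [p [g [[d [_ d_sort [ZE lE rE piE]]] step]]]] c'v.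
have [f [delta [fs fval [deltaP pi_true] fdelta [u cu [sub_u ->]]]]] :=
  partial_step_instance step c'v.
have Vd x : (Var (r_lhs rho) `|` Var (r_rhs rho)) x ->
    (Var (r_lhs rho') `|` Var (r_rhs rho')) (d x).
  by rewrite lE rE => -[xV|xV]; [left|right]; exact: vars_rename.
(* The step uses the variant [rho'], but [trs_interp R] is built from [rho]; composing [f] and
   [delta] with the renaming [d] transfers the data. *)
have [|||||l [r [th [lr thl thr]]]] :=
    @rule_instance rho (fun x => f (d x)) (fun x => delta (d x)).
- by move=> x; rewrite -d_sort.
- by move=> x xZ /Vd; apply: fval; rewrite ZE; exists x.
- by move=> x xth; rewrite deltaP ?d_sort // /theory_var d_sort.
- by rewrite -pi_true piE /rename_term eval_tsubst.
- move=> x xpi /Vd; apply: fdelta; rewrite piE; exact: vars_rename.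
exists u => //; exists p, l, r, th; split.
- by exists rho.
- by rewrite sub_u thl lE /rename_term tsubst_tsubst.
- by rewrite thr rE /rename_term tsubst_tsubst.
Qed.

Lemma partial_steps_backward (R : set (rule S)) c c' :
  partial_steps R c c' -> forall v, ct_interp c' v ->
  exists2 u, ct_interp c u & rewrite_steps (trs_interp R) u v.
Proof.
elim=> {c c'} [c c' step v|c v cv|c1 c2 c3 _ IH12 _ IH23 v].
- by case/(partial_step_backward step)=> u cu uv; exists u => //; exact: rt_step.
- by exists v => //; exact: rt_refl.
- case/IH23=> w /IH12[u cu uw] wv; exists u => //; exact: rt_trans uw wv.
Qed.

Lemma partial_steps_sat (R : set (rule S)) c c' :
  partial_steps R c c' -> ct_sat c -> ct_sat c'.
Proof.
elim=> {c c'} [c c' [rho _ [rho' [p [g [_ step]]]]] _|//|c1 c2 c3 _ IH12 _ IH23].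
  exact: partial_step_sat step.
by move/IH12/IH23.
Qed.

End PartialRewriting.

Theorem theorem4p8 (S : signature) (R : set (rule S)) (c c' : ecterm S)
    (HR : lctrs R) (Hsteps : partial_steps R c c') :
  (forall v, ct_interp c' v ->
     exists2 u, ct_interp c u & rewrite_steps (trs_interp R) u v) /\
  (ct_sat c ->
     exists u v, [/\ ct_interp c u, ct_interp c' v &
                     rewrite_steps (trs_interp R) u v]).
Proof.
split=> [|/(partial_steps_sat Hsteps)/ct_interp_sat[v c'v]].
  exact: partial_steps_backward.
have [u cu uv] := partial_steps_backward Hsteps c'v.
by exists u, v.
Qed.
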